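(* Let $F$ be an algebraically closed field of characteristic $p>0$, let $G$ be a finite group and let $Q$ be a normal $p$-subgroup of $G$. Let $G_p$ denote the set of $p$-elements of $G$ and $G_p^+ := \sum_{x\in G_p} x \in FG$. Then the number of blocks of defect zero of the group algebra $F[G/Q]$ equals the $F$-dimension of the ideal $\mathrm{W}_Q(FG) := \mathrm{Tr}_Q^G(FG\cdot G_p^+)$ of the center $\mathrm{Z}(FG)$.
   Context: For a subgroup $X$ of $G$, $(FG)^X := \{a\in FG : xax^{-1}=a \text{ for all } x\in X\}$. For subgroups $Y\le X\le G$, the relative trace map $\mathrm{Tr}_Y^X:(FG)^Y\to (FG)^X$ is defined by $a\mapsto \sum_{xY\in X/Y} xax^{-1}$ (sum over a set of left coset representatives). Note $FG\cdot G_p^+\subseteq (FG)^Q$ since $uG_p^+=G_p^+$ for $u\in Q$. *)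

(* Defs.v *)
From HB Require Import structures.
From mathcomp Require Import all_boot all_order all_algebra all_fingroup all_solvable all_field.
Set Implicit Arguments. Unset Strict Implicit. Unset Printing Implicit Defensive.
Import GRing.Theory.
Local Open Scope ring_scope.

(* Group algebra F[H] of a subgroup H of a finite group type gT, realised as
   the F-subspace of functions gT -> F supported on H (an element
   \sum_x a_x x is the function x |-> a_x).  We use F^o (regular vector
   space) so that {ffun gT -> F^o} is an F-vector space (vectType). *)
Section GroupAlgebra.
Variables (F : fieldType) (gT : finGroupType).
Local Notation alg := {ffun gT -> F^o}.

Definition inalg (H : {set gT}) (a : alg) : Prop := forall x, x \notin H -> a x = 0.

Definition gdelta (g : gT) : alg := [ffun z => (z == g)%:R].

Definition gmul (a b : alg) : alg := [ffun z => \sum_x a x * b (x^-1 * z)%g].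

(* conjugation y a y^-1 : its coefficient at z is a(y^-1 z y) = a(z ^ y) *)
Definition gconj (y : gT) (a : alg) : alg := [ffun z => a (z ^ y)%g].

Definition fixed_in (H X : {set gT}) (a : alg) : Prop :=
  inalg H a /\ forall x, x \in X -> gconj x a = a.

Definition rtrace (Y X : {set gT}) (a : alg) : alg :=
  \sum_(C in lcosets Y X) gconj (repr C) a.

Definition pplus (p : nat) (G : {set gT}) : alg :=
  \sum_(x in G | (p.-elt x)%g) gdelta x.

(* W_Q(FG) = Tr_Q^G(FG . G_p^+), the F-span of the Tr_Q^G(g G_p^+), g in G *)
Definition WQ (p : nat) (G Q : {set gT}) : {vspace alg} :=
  <<[seq rtrace Q G (gmul (gdelta g) (pplus p G)) | g <- enum G]>>%VS.

Definition central_idem (H : {set gT}) (e : alg) : Prop :=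
  inalg H e /\ (forall a, inalg H a -> gmul a e = gmul e a) /\ gmul e e = e.

Definition block (H : {set gT}) (e : alg) : Prop :=
  central_idem H e /\ e != 0 /\
  ~ (exists e1 e2, central_idem H e1 /\ central_idem H e2 /\ e1 != 0 /\ e2 != 0 /\
                   gmul e1 e2 = 0 /\ e = e1 + e2).

(* defect group of a block e of F[H] (Green): a p-subgroup D of H minimal
   with respect to e \in Tr_D^H((F H)^D). *)
Definition defect_group (p : nat) (H : {set gT}) (e : alg) (D : {group gT}) : Prop :=
  [/\ D \subset H, (p.-group D)%g,
      exists2 a, fixed_in H D a & e = rtrace D H a
    & forall E : {group gT}, E \proper D ->
        ~ exists2 a, fixed_in H E a & e = rtrace E H a].

Definition defect_zero_block (p : nat) (H : {set gT}) (e : alg) : Prop :=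
  block H e /\ defect_group p H e 1%G.

End GroupAlgebra.

(* Main.v *)
Require Import Defs.
From HB Require Import structures.
From mathcomp Require Import all_boot all_order all_algebra all_fingroup all_solvable all_field.
Set Implicit Arguments. Unset Strict Implicit. Unset Printing Implicit Defensive.
Import GRing.Theory VectorInternalTheory.
Local Open Scope ring_scope.

(* Sending a coset gQ to the sum of its elements embeds F[G/Q] in FG and maps
   Tr_1(F[G/Q] (G/Q)_p^+) onto W_Q(FG), so with H = G/Q one has to count the
   blocks of defect zero by the dimension of I = T(FH s) = T(FH) s, where
   T = Tr_1^H and s = H_p^+ is central.  Let lam be the coefficient at 1.
   (1) lam(s x)^q = lam(x^q) for large powers q of p.  Hence s annihilates the
       nilpotent elements of Z(FH).
   (2) lam(T(a) y) is the trace of x |-> a x y on FH, hence 0 for y nilpotent.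
       So T(a) annihilates the nilpotent elements of Z(FH).
   (3) As F is algebraically closed, every y in FH is congruent to a q-th power
       h(y)^q, with h a polynomial vanishing at 0, modulo a nilpotent element
       of F[y].
   If z = T(a) s has square 0 then T(a)^2 s = 0 by (2), and (1) and (3) for
   T(a) give z = 0.  So I is a reduced ideal of Z(FH), hence is spanned by
   orthogonal idempotents, which are blocks, and have defect zero because
   they lie in the image of T.  Conversely, let e = T(a) be a block of defect
   zero.  If e s = 0, then lam(e b) = lam(e h(b)^q) = lam(s e h(b))^q = 0 for
   all b by (3), (2) and (1), so e = 0.  Thus e s is a nonzero element of I, so
   e meets, and by primitivity equals, one of the idempotents spanning I. *)

(** * Finite-dimensional algebras over an algebraically closed field *)

(** The powers of [y] from exponent 0 to [dim A] are one too many to be independent; a kernel row of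
    the matrix of these powers supplies the coefficients. *)
Lemma annihilating_poly (F : fieldType) (A : falgType F) (y : A) :
  exists2 m : {poly F}, m != 0 & horner_alg y m = 0.
Proof.
pose M := \matrix_(i < (dim A).+1) v2r (y ^+ i).
have nzK : kermx M != 0.
  rewrite -mxrank_eq0 mxrank_ker subn_eq0 -ltnNge.
  by rewrite ltnS (leq_trans (rank_leq_col M)).
pose u := nz_row (kermx M).
have uM : u *m M = 0 by apply/sub_kermxP/nz_row_sub.
exists (rVpoly u); first by rewrite raddf_eq0 ?nz_row_eq0 //; apply: can_inj rVpolyK.
apply: (can_inj v2rK); rewrite linear0 -uM /rVpoly poly_def linear_sum linear_sum mulmx_sum_row.
apply: eq_bigr => i _; rewrite valK rowK /= -mul_polyC rmorphM rmorphXn /= horner_algC mulr_algl.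
by rewrite horner_algX linearZ.
Qed.

(** Adding a multiple of the product of all ['X - z%:P] over the old nodes adjusts the value at a
    new node and keeps the old values. Prescribing values by a relation avoids choosing a root
    function beforehand. *)
Lemma poly_interpolation (F : fieldType) (R : F -> F -> Prop) (r : seq F) :
    (forall c, exists d, R c d) ->
  exists h : {poly F}, {in r, forall c, R c h.[c]}.
Proof.
move=> exR; elim: r => [|c r [h Rh]]; first by exists 0.
have [rc|nrc] := boolP (c \in r).
  by exists h => x; rewrite inE => /predU1P[->|]; apply: Rh.
have [d Rd] := exR c; pose P := \prod_(z <- r) ('X - z%:P).
have nzP : P.[c] != 0 by rewrite -rootE root_prod_XsubC.
exists (h + ((d - h.[c]) / P.[c])%:P * P) => x; rewrite inE hornerD hornerCM.
case/predU1P=> [->|rx]; first by rewrite divfK // addrC subrK.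
by have /rootP-> : root P x; rewrite ?root_prod_XsubC // mulr0 addr0; apply: Rh.
Qed.

Lemma closed_field_exproot (F : closedFieldType) (q : nat) (c : F) :
  (0 < q)%N -> exists d, d ^+ q = c.
Proof.
move=> q_gt0; have [|d /rootP] := @closed_rootP F ('X^q - c%:P) _.
  by rewrite size_XnsubC // eqSS -lt0n.
by rewrite !hornerE => /eqP; rewrite subr_eq0 => /eqP; exists d.
Qed.

(* The polynomial interpolates a [q]-th root on the spectrum of [y]; it also
   vanishes at [0], whether or not [0] is an eigenvalue. *)
Lemma exists_root_mod_nilpotent (F : closedFieldType) (A : falgType F) (y : A)
    (q : nat) : (0 < q)%N ->
  exists2 h : {poly F}, h.[0] = 0 &
    exists N, (y - horner_alg y h ^+ q) ^+ N = 0.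
Proof.
move=> q_gt0; have [m nzm my0] := annihilating_poly y.
have [r mE] := closed_field_poly_normal m.
have [h hP] := poly_interpolation (0 :: r) (fun c => closed_field_exproot c q_gt0).
exists h.
  by apply/eqP; have /eqP := hP 0 (mem_head _ _); rewrite expf_eq0 q_gt0.
pose g := 'X - h ^+ q; exists (size r).
suff /dvdpP[k kE] : (\prod_(z <- r) ('X - z%:P)) %| g ^+ size r.
  have gE : horner_alg y g = y - horner_alg y h ^+ q.
    by rewrite rmorphB /= horner_algX rmorphXn.
  rewrite -gE -rmorphXn kE rmorphM /=.
  suff -> : horner_alg y (\prod_(z <- r) ('X - z%:P)) = 0 by rewrite mulr0.
  apply: (scalerI (a := lead_coef m)); first by rewrite lead_coef_eq0.
  by rewrite scaler0 -mulr_algl -(horner_algC y) -rmorphM mul_polyC -mE.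
have: {in r, forall c, root g c}.
  move=> c rc; rewrite /root !hornerE hP ?subrr // inE rc orbT //.
elim: r {mE hP} => [|c r IHr] rP; first by rewrite big_nil dvd1p.
rewrite big_cons exprS dvdp_mul ?dvdp_XsubCl ?rP ?mem_head // IHr // => x rx.
by rewrite rP // inE rx orbT.
Qed.

(** Apply the linear factors of an annihilating polynomial of [x] to a nonzero vector of [V], one
    after another: the last nonzero vector obtained is an eigenvector, and stability keeps it in
    [V]. *)
Lemma eigenvector_in_stable_space (F : closedFieldType) (A : falgType F)
    (x : A) (V : {vspace A}) :
    V != 0%VS -> (forall v, v \in V -> x * v \in V) ->
  exists c, exists2 v, v \in V & v != 0 /\ x * v = c *: v.
Proof.
move=> nzV xV; have [m nzm mx0] := annihilating_poly x.
have [r mE] := closed_field_poly_normal m.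
have mr0 : horner_alg x (\prod_(z <- r) ('X - z%:P)) = 0.
  apply: (scalerI (a := lead_coef m)); first by rewrite lead_coef_eq0.
  by rewrite scaler0 -mulr_algl -(horner_algC x) -rmorphM mul_polyC -mE.
have: horner_alg x (\prod_(z <- r) ('X - z%:P)) * vpick V = 0 by rewrite mr0 mul0r.
have := memv_pick V; have : vpick V != 0 by rewrite vpick0.
elim: r {mE mr0} (vpick V) => [|c r IHr] v nzv Vv.
  by rewrite big_nil rmorph1 mul1r => v0; rewrite v0 eqxx in nzv.
rewrite big_cons mulrC rmorphM /= rmorphB /= horner_algX horner_algC -mulrA.
rewrite mulrBl mulr_algl.
have [/eqP|nz] := eqVneq (x * v - c *: v) 0.
  by rewrite subr_eq0 => /eqP xv _; exists c, v.
by apply: IHr => //; rewrite memvB ?memvZ ?xV.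
Qed.

(** Shrink [V] to an eigenspace of one basis vector of [U] after another; commutativity keeps each
    eigenspace stable under [U]. *)
Lemma common_eigenvector_in_stable_space (F : closedFieldType) (A : falgType F)
    (U V : {vspace A}) :
    V != 0%VS -> {in U & V, forall z v, z * v \in V} ->
    {in U &, forall z w, z * w = w * z} ->
  exists2 v, v \in V & v != 0 /\ forall z, z \in U -> exists c, z * v = c *: v.
Proof.
move=> nzV UV cU; pose X := vbasis U : seq A.
suff [V' [nzV' sV'V _ XV']] : exists V' : {vspace A},
    [/\ V' != 0%VS, (V' <= V)%VS, {in U & V', forall z v, z * v \in V'} &
        {in X, forall x, exists c, {in V', forall v, x * v = c *: v}}].
  exists (vpick V'); first exact: subvP sV'V _ (memv_pick _).
  split=> [|z Uz]; first by rewrite vpick0.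
  rewrite (coord_vbasis Uz) mulr_suml.
  elim/big_ind: _ => [|a b [c ->] [d ->]|i _]; first by exists 0; rewrite scale0r.
    by exists (c + d); rewrite scalerDl.
  have [|c cP] := XV' (vbasis U)`_i; first by rewrite mem_nth // size_tuple.
  by exists (coord (vbasis U) i z * c); rewrite -scalerAl cP ?memv_pick ?scalerA.
have: {subset X <= U} by move=> x /vbasis_mem.
elim: (X) => [|x Y IHY] XU; first by exists V; split.
have [|V' [nzV' sV'V UV' YV']] := IHY.
  by move=> y Yy; rewrite XU // inE Yy orbT.
have Ux : x \in U by rewrite XU ?mem_head.
have [c [v V'v [nzv xv]]] := eigenvector_in_stable_space nzV' (fun v => UV' x v Ux).
(* The eigenspace of [x] for [c] inside [V']. *)
pose V'' := (V' :&: lker (amull x - c *: \1%VF))%VS.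
have V''P w : w \in V'' = (w \in V') && (x * w == c *: w).
  rewrite memv_cap memv_ker add_lfunE opp_lfunE scale_lfunE id_lfunE lfunE /=.
  by rewrite subr_eq0.
exists V''; split.
- apply: contraNneq nzv => V''0; rewrite -memv0 -V''0 V''P V'v.
  exact/eqP.
- exact: subv_trans (capvSl _ _) sV'V.
- move=> z w Uz; rewrite !V''P => /andP[V'w /eqP xw]; rewrite UV' //=.
  by rewrite mulrA (cU x) // -mulrA xw scalerAr.
move=> y; rewrite inE => /predU1P[->|Yy].
  by exists c => w; rewrite V''P => /andP[_ /eqP].
by have [d dP] := YV' y Yy; exists d => w; rewrite V''P => /andP[V'w _]; apply: dP.
Qed.

(** Let [U] act on itself. A common eigenvector [u] in [U] has [u * u = c *: u], where [c != 0]
    because [U] is reduced, so [c^-1 *: u] is an idempotent. Split it off and induct on the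
    dimension. *)
Lemma reduced_idempotent_basis (F : closedFieldType) (A : falgType F)
    (U : {vspace A}) :
    {in U &, forall z w, z * w \in U} -> {in U &, forall z w, z * w = w * z} ->
    {in U, forall z, z * z = 0 -> z = 0} ->
  exists s : seq A, [/\ basis_of U s, {in s, forall e, e * e = e} &
                        {in s &, forall e f, e != f -> e * f = 0}].
Proof.
have [n] := ubnP (\dim U); elim: n => // n IHn in U *; rewrite ltnS => leUn mU cU rU.
have [->|nzU] := eqVneq U 0%VS; first by exists [::]; rewrite nil_basis.
have [u Uu [nzu uP]] := common_eigenvector_in_stable_space nzU mU cU.
have [c uu] := uP u Uu.
have nzc : c != 0.
  by apply: contraNneq nzu => c0; rewrite (rU u) // uu c0 scale0r.
pose e := c^-1 *: u; have Ue : e \in U by rewrite memvZ.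
have ee : e * e = e.
  by rewrite /e -scalerAl -scalerAr uu !scalerA mulfVK.
have eP z : z \in U -> exists d, z * e = d *: e.
  by move=> /uP[d zu]; exists d; rewrite /e -scalerAr zu !scalerA mulrC.
have nze : e != 0 by rewrite scaler_eq0 invr_eq0 (negPf nzc).
(* The annihilator of [e] in [U], which is the complement of the line through [e]: write [z] as
   [(z - z * e) + z * e]. *)
pose U' := (U :&: lker (amulr e))%VS.
have U'P w : w \in U' = (w \in U) && (w * e == 0).
  by rewrite memv_cap memv_ker lfunE.
have sU'U : (U' <= U)%VS by apply: capvSl.
have [||||s [bs ids orths]] := IHn U'.
- apply: leq_trans leUn; rewrite (ltn_leqif (dimv_leqif_sup sU'U)).
  by apply/negP=> /subvP/(_ e Ue); rewrite U'P ee (negPf nze) andbF.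
- move=> z w; rewrite !U'P => /andP[Uz _] /andP[Uw /eqP we].
  by rewrite mU //= -mulrA we mulr0.
- by move=> z w /(subvP sU'U) Uz /(subvP sU'U); apply: cU.
- by move=> z /(subvP sU'U); apply: rU.
have sU' f : f \in s -> f \in U' by apply: basis_mem.
have es0 f : f \in s -> (f * e = 0) * (e * f = 0).
  move=> /sU'; rewrite U'P => /andP[Uf /eqP fe].
  by split; rewrite // cU.
have neU' : e \notin U' by rewrite U'P ee (negPf nze) andbF.
exists (e :: s); split.
- rewrite /basis_of free_cons span_cons (span_basis bs) neU' (basis_free bs) /= andbT.
  rewrite eqEsubv subv_add -memvE Ue sU'U /=; apply/subvP=> z Uz.
  have [d zd] := eP z Uz; rewrite -(subrK (z * e) z) addrC memv_add //.
    by rewrite zd memvZ ?memv_line.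
  by rewrite U'P memvB ?mU //= mulrBl -mulrA ee subrr.
- by move=> f; rewrite inE => /predU1P[->|/ids].
move=> f g; rewrite !inE => /predU1P[->|sf] /predU1P[->|sg].
- by rewrite eqxx.
- by rewrite es0.
- by rewrite es0.
- exact: orths.
Qed.

(** * Traces of nilpotent endomorphisms *)

(** All eigenvalues are 0, so the characteristic polynomial is a power of ['X], and the trace is, up
    to sign, its second highest coefficient. *)
Lemma mxtrace_nilpotent (F : closedFieldType) n (M : 'M[F]_n) k :
  M ^+ k = 0 -> \tr M = 0.
Proof.
case: n M => [|n] M Mk0; first by rewrite /mxtrace big_ord0.
apply/eqP; rewrite -oppr_eq0 -char_poly_trace //; apply/eqP.
have [r] := closed_field_poly_normal (char_poly M).
rewrite (monicP (char_poly_monic M)) scale1r => rE.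
have r0 c : c \in r -> c = 0.
  rewrite -root_prod_XsubC -rE -eigenvalue_root_char => /eigenvalueP[v vM nzv].
  have vMk m : v *m M ^+ m = c ^+ m *: v.
    elim: m => [|m IHm]; first by rewrite mulmx1 scale1r.
    by rewrite exprSr mulmxA IHm -scalemxAl vM scalerA -exprSr.
  have /eqP := vMk k; rewrite Mk0 mulmx0 eq_sym scaler_eq0 (negPf nzv) orbF.
  by rewrite expf_eq0 => /andP[_ /eqP].
have rX : \prod_(z <- r) ('X - z%:P) = 'X^(size r) :> {poly F}.
  rewrite (eq_big_seq (fun=> 'X)) => [|z /r0->]; last by rewrite subr0.
  by rewrite big_const_seq count_predT iter_mulr mulr1.
have := size_char_poly M; rewrite rE rX size_polyXn coefXn => -[->].
by rewrite ltn_eqF.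
Qed.

(** The sum is the trace of [f] in the basis of indicator functions. *)
Lemma nilpotent_linear_trace (F : closedFieldType) (X : finType)
    (f : {linear {ffun X -> F^o} -> {ffun X -> F^o}}) k :
    (forall a, iter k f a = 0) ->
  \sum_x f [ffun z => (z == x)%:R] x = 0.
Proof.
move=> fk0; pose d x : {ffun X -> F^o} := [ffun z => (z == x)%:R].
have aE (a : {ffun X -> F^o}) : a = \sum_x a x *: d x.
  apply/ffunP=> z; rewrite sum_ffunE (bigD1 z) //= big1 => [|x /negPf nx].
    by rewrite !ffunE eqxx addr0 /GRing.scale /= mulr1.
  by rewrite !ffunE eq_sym nx scaler0.
have evb : {on xpredT, bijective (fun i : 'I_#|X| => enum_val i)}.
  exact: onW_bij (enum_val_bij X).
pose M := \matrix_(i < #|X|, j < #|X|) (f (d (enum_val i)) (enum_val j) : F).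
have MX m i j : (M ^+ m) i j = iter m f (d (enum_val i)) (enum_val j).
  elim: m i j => [|m IHm] i j.
    by rewrite !mxE ffunE (inj_eq enum_val_inj) eq_sym.
  rewrite exprSr mxE iterS [in RHS](aE (iter m f _)) linear_sum sum_ffunE.
  rewrite (reindex _ evb) /=.
  by apply: eq_bigr => l _; rewrite IHm mxE linearZ ffunE.
transitivity (\tr M); last first.
  by apply: (@mxtrace_nilpotent _ _ M k); apply/matrixP=> i j; rewrite MX fk0 mxE ffunE.
rewrite (reindex _ evb) /=.
by apply: eq_bigr => l _; rewrite mxE.
Qed.

(** * Orbits of p-permutations and cyclic rotation *)

(** On a nontrivial orbit [w] is constant and the number of points is a positive power of [p], so
    the orbit contributes 0. *)
Lemma sum_pperm_invariant (R : nzRingType) (p : nat) (X : finType)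
    (s : {perm X}) (w : X -> R) :
    p \in [pchar R] -> (p.-elt s)%g -> (forall x, w (s x) = w x) ->
  \sum_x w x = \sum_(x | s x == x) w x.
Proof.
move=> pR ps ws; rewrite (bigID (fun x => s x == x)) /= -[RHS]addr0; congr (_ + _).
rewrite (partition_big (porbit s) predT) //= big1 // => O _.
have [x /andP[sx /eqP Ox]|no] := pickP [pred x | (s x != x) && (porbit s x == O)];
  last by rewrite big_pred0.
have wX y : y \in porbit s x -> w y = w x.
  case/porbitP=> i ->; elim: i => [|i IHi]; first by rewrite expg0 perm1.
  by rewrite expgSr permM ws.
rewrite (eq_bigl (mem (porbit s x))) => [|y /=]; last first.
  rewrite -Ox eq_porbit_mem andb_idl // => /porbitP[i ->].
  by rewrite -permM -expgSr expgS permM (inj_eq perm_inj).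
rewrite (eq_bigr (fun=> w x)) => [|y]; last exact: wX.
rewrite sumr_const; apply/eqP; rewrite -mulr_natr.
suff /eqP-> : #|porbit s x|%:R == 0 :> R by rewrite mulr0.
rewrite -(dvdn_pcharf pR).
have : p.-nat #|porbit s x|.
  rewrite porbitE card_orbit; apply: pnat_dvd (dvdn_indexg _ _) _.
  by rewrite -orderE.
case/p_natP=> -[|m] xm; last by rewrite xm expnS dvdn_mulr.
(* An orbit of size [p ^ 0] would consist of a fixed point, against the choice of [x]. *)
have := mem_porbit s 1 x; rewrite expg1.
have /eqP/cards1P[z zE] := xm; move: (porbit_id s x) sx.
by rewrite zE !inE => /eqP-> /negPf->.
Qed.

(** Rotation only conjugates the product, so it preserves the set of tuples with product 1. *)
Lemma prodg_ordS (gT : finGroupType) n (f : 'I_n.+1 -> gT) :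
  (\prod_i f (ordS i) = (\prod_i f i) ^ f ord0)%g.
Proof.
rewrite big_ord_recr big_ord_recl conjgE mulgA mulKg /=.
congr (_ * f _)%g; last by apply/val_inj; rewrite /= modnn.
apply: eq_bigr => i _; congr f; apply/val_inj.
by rewrite /= modn_small ?ltnS.
Qed.

(** * The group algebra as a ring *)

Section GroupAlgebraRing.
Variables (F : fieldType) (gT : finGroupType).

(* An alias is needed: [{ffun gT -> F^o}] already carries the pointwise product. *)
Definition galg : Type := {ffun gT -> F^o}.
HB.instance Definition _ := Vector.copy galg {ffun gT -> F^o}.

Lemma gmulA : associative (@gmul F gT).
Proof.
move=> a b c; apply/ffunP=> z; rewrite !ffunE.
under [RHS]eq_bigr => y _ do rewrite ffunE mulr_suml.
rewrite exchange_big; apply: eq_bigr => x _ /=.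
rewrite ffunE mulr_sumr (reindex_inj (mulgI x^-1%g)) /=.
by apply: eq_bigr => y _; rewrite mulrA invMg invgK -!mulgA mulKVg.
Qed.

Lemma gmul1a : left_id (gdelta F 1%g) (@gmul F gT).
Proof.
move=> a; apply/ffunP=> z; rewrite ffunE (bigD1 1%g) //= big1 => [|x /negPf nx].
  by rewrite ffunE eqxx mul1r invg1 mul1g addr0.
by rewrite ffunE nx mul0r.
Qed.

Lemma gmula1 : right_id (gdelta F 1%g) (@gmul F gT).
Proof.
move=> a; apply/ffunP=> z; rewrite ffunE (bigD1 z) //= big1 => [|x nx].
  by rewrite ffunE mulVg eqxx mulr1 addr0.
by rewrite ffunE -eq_mulVg1 (negPf nx) mulr0.
Qed.

Lemma gmulDl : left_distributive (@gmul F gT) +%R.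
Proof.
move=> a b c; apply/ffunP=> z; rewrite !ffunE -big_split; apply: eq_bigr => x _.
by rewrite ffunE mulrDl.
Qed.

Lemma gmulDr : right_distributive (@gmul F gT) +%R.
Proof.
move=> a b c; apply/ffunP=> z; rewrite !ffunE -big_split; apply: eq_bigr => x _.
by rewrite ffunE mulrDr.
Qed.

Lemma gdelta1_neq0 : gdelta F 1%g != 0 :> {ffun gT -> F^o}.
Proof. by apply/eqP=> /ffunP/(_ 1%g)/eqP; rewrite !ffunE eqxx oner_eq0. Qed.

HB.instance Definition _ := GRing.Zmodule_isNzRing.Build galg
  gmulA gmul1a gmula1 gmulDl gmulDr gdelta1_neq0.

Lemma gscaleAl (c : F) (a b : galg) : c *: (a * b) = (c *: a) * b.
Proof.
apply/ffunP=> z; rewrite !ffunE scaler_sumr; apply: eq_bigr => x _.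
by rewrite ffunE -scalerAl.
Qed.

HB.instance Definition _ := GRing.Lmodule_isLalgebra.Build F galg gscaleAl.

Lemma gscaleAr (c : F) (a b : galg) : c *: (a * b) = a * (c *: b).
Proof.
apply/ffunP=> z; rewrite !ffunE scaler_sumr; apply: eq_bigr => x _.
by rewrite ffunE -scalerAr.
Qed.

HB.instance Definition _ := GRing.Lalgebra_isAlgebra.Build F galg gscaleAr.

HB.instance Definition _ := Algebra_isFalgebra.Build F galg.

Lemma galg_mulE (a b : galg) : a * b = gmul a b.
Proof. by []. Qed.

Lemma gdelta1 : gdelta F 1%g = 1 :> galg.
Proof. by []. Qed.

Lemma gdelta_mull (g : gT) (a : galg) z : ((gdelta F g : galg) * a) z = a (g^-1 * z)%g.
Proof.
rewrite galg_mulE ffunE (bigD1 g) //= big1 => [|x /negPf nx].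
  by rewrite ffunE eqxx mul1r addr0.
by rewrite ffunE nx mul0r.
Qed.

Lemma gdelta_mulr (g : gT) (a : galg) z : (a * (gdelta F g : galg)) z = a (z * g^-1)%g.
Proof.
rewrite galg_mulE ffunE (bigD1 (z * g^-1)%g) //= big1 => [|x nx].
  by rewrite ffunE invMg invgK mulgKV eqxx mulr1 addr0.
rewrite ffunE -(inj_eq (mulgI x)) mulKVg -(inj_eq (mulIg g^-1)%g) mulgK.
by rewrite eq_sym (negPf nx) mulr0.
Qed.

Lemma gdeltaM (g h : gT) : (gdelta F g : galg) * gdelta F h = gdelta F (g * h)%g.
Proof.
by apply/ffunP=> z; rewrite gdelta_mull !ffunE -(inj_eq (mulgI g)) mulKVg.
Qed.

Lemma galgE (a : galg) : a = \sum_g a g *: (gdelta F g : galg).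
Proof.
apply/ffunP=> z; rewrite sum_ffunE (bigD1 z) //= big1 => [|x /negPf nx].
  by rewrite !ffunE eqxx addr0 /GRing.scale /= mulr1.
by rewrite !ffunE eq_sym nx scaler0.
Qed.

Lemma gconjE (y : gT) (a : galg) :
  gconj y a = (gdelta F y : galg) * a * gdelta F y^-1%g.
Proof.
apply/ffunP=> z.
by rewrite gdelta_mulr gdelta_mull ffunE invgK conjgE mulgA.
Qed.

Lemma prod_scale_gdelta n (c : 'I_n -> F) (g : 'I_n -> gT) :
  \prod_i (c i *: (gdelta F (g i) : galg)) =
    (\prod_i c i) *: (gdelta F (\prod_i g i)%g : galg).
Proof.
elim/big_rec3: _ => [|i a x y _ ->]; first by rewrite scale1r.
by rewrite -scalerAl -scalerAr scalerA gdeltaM.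
Qed.

(* The [p ^ k]-tuples of group elements with product [1] are permuted by cyclic
   rotation; in characteristic [p] only the constant tuples contribute. *)
Lemma coef1_exp_pchar (p k : nat) (a : galg) : p \in [pchar F] ->
  (a ^+ (p ^ k)) 1%g = \sum_(g | (g ^+ (p ^ k) == 1)%g) (a g) ^+ (p ^ k).
Proof.
move=> pF; have p_pr := pcharf_prime pF.
have: (0 < p ^ k)%N by rewrite expn_gt0 prime_gt0.
have: p.-nat (p ^ k)%N by rewrite pnatX pnat_id.
case: (p ^ k)%N => // q pq _.
have -> : a ^+ q.+1 = \prod_(i < q.+1) \sum_g a g *: (gdelta F g : galg).
  by rewrite -galgE prodr_const card_ord.
rewrite bigA_distr_bigA sum_ffunE /=.
(* The contribution of the tuple [f] to the coefficient at 1 of the expanded power. *)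
pose w (f : {ffun 'I_q.+1 -> gT}) : F :=
  (\prod_i a (f i)) * (1%g == (\prod_i f i)%g)%:R.
rewrite (eq_bigr w) => [|f _]; last first.
  by rewrite prod_scale_gdelta !ffunE.
pose rotf (f : {ffun 'I_q.+1 -> gT}) := [ffun i => f (ordS i)].
have rotf_inj : injective rotf.
  move=> f g /ffunP fg; apply/ffunP=> i; have := fg (ord_pred i).
  by rewrite !ffunE ord_predK.
have iter_ordS n (i : 'I_q.+1) : nat_of_ord (iter n (@ordS q.+1) i) = ((i + n) %% q.+1)%N.
  elim: n => [|n IHn]; first by rewrite addn0 modn_small.
  by rewrite iterS /= IHn -addn1 modnDml addn1 addnS.
have iter_rotf n f i : iter n rotf f i = f (iter n (@ordS q.+1) i).
  elim: n f i => // n IHn f i.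
  by rewrite iterS ffunE IHn -iterSr.
rewrite (@sum_pperm_invariant _ p _ (perm rotf_inj) w pF); first last.
- move=> f; rewrite permE /w; congr (_ * _).
    rewrite [RHS](reindex_inj (@ordS_inj _)).
    by apply: eq_bigr => i _; rewrite ffunE.
  under eq_bigr => i _ do rewrite ffunE.
  by rewrite prodg_ordS eq_sym conjg_eq1 eq_sym.
- apply: pnat_dvd pq; rewrite order_dvdn; apply/eqP/permP=> f.
  rewrite permX perm1 (eq_iter (permE _)); apply/ffunP=> i.
  rewrite iter_rotf; congr (f _); apply/ord_inj.
  by rewrite iter_ordS modnDr modn_small.
(* A tuple fixed by rotation is constant, hence determined by its entry at [ord0]. *)
rewrite (reindex_onto (fun g => [ffun=> g]) (fun f : {ffun 'I_q.+1 -> gT} => f ord0)) /=; last first.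
  move=> f; rewrite permE => /eqP ff; apply/ffunP=> i; rewrite ffunE.
  have <- : iter i (@ordS q.+1) ord0 = i.
    by apply/ord_inj; rewrite iter_ordS add0n modn_small.
  by rewrite -iter_rotf; elim: (nat_of_ord i) => // n IHn; rewrite iterSr ff.
under eq_bigl => g do rewrite permE !ffunE eqxx andbT.
rewrite (eq_bigl xpredT) => [|g]; last first.
  by apply/eqP/ffunP=> i; rewrite !ffunE.
rewrite [RHS]big_mkcond /=; apply: eq_bigr => g _; rewrite /w.
under eq_bigr => i _ do rewrite ffunE.
rewrite prodr_const card_ord (_ : \prod_i _ = g ^+ q.+1)%g; last first.
  under eq_bigr => i _ do rewrite ffunE.
  by rewrite big_const_ord; elim: q.+1 => // n IHn; rewrite expgS iterS IHn.
by rewrite eq_sym; case: eqP; rewrite ?mulr1 ?mulr0.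
Qed.

End GroupAlgebraRing.

(** * The trace map and the sum of the p-elements *)

Section SubgroupAlgebra.
Variables (F : fieldType) (gT : finGroupType) (H : {group gT}).
Local Notation A := (galg F gT).
Implicit Types a b z : A.

Lemma inalg_gdelta h : h \in H -> inalg H (gdelta F h).
Proof. by move=> Hh x; rewrite ffunE; case: eqP => // ->; rewrite Hh. Qed.

Lemma inalg0 : inalg H (0 : A).
Proof. by move=> x _; rewrite ffunE. Qed.

Lemma inalg1 : inalg H (1 : A).
Proof. exact/inalg_gdelta/group1. Qed.

Lemma inalgD a b : inalg H a -> inalg H b -> inalg H (a + b).
Proof. by move=> Ha Hb x Hx; rewrite ffunE Ha ?Hb ?addr0. Qed.

Lemma inalgZ c a : inalg H a -> inalg H (c *: a).
Proof. by move=> Ha x Hx; rewrite ffunE Ha ?scaler0. Qed.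

Lemma inalgB a b : inalg H a -> inalg H b -> inalg H (a - b).
Proof. by move=> Ha Hb; rewrite -scaleN1r; apply/inalgD/inalgZ. Qed.

Lemma inalgM a b : inalg H a -> inalg H b -> inalg H (a * b).
Proof.
move=> Ha Hb x Hx; rewrite ffunE big1 // => y _.
have [Hy|/Ha->] := boolP (y \in H); last by rewrite mul0r.
by rewrite Hb ?mulr0 // groupMl ?groupV.
Qed.

Lemma inalgX a n : inalg H a -> inalg H (a ^+ n).
Proof.
by move=> Ha; elim: n => [|n IHn]; [apply: inalg1 | rewrite exprS; apply: inalgM].
Qed.

Lemma inalg_sum I (r : seq I) (P : pred I) (f : I -> A) :
  (forall i, P i -> inalg H (f i)) -> inalg H (\sum_(i <- r | P i) f i).
Proof.
move=> Hf; elim/big_ind: _ => //; [exact: inalg0 | exact: inalgD].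
Qed.

Lemma inalg_horner a (h : {poly F}) : inalg H a -> inalg H (horner_alg a h).
Proof.
move=> Ha; elim/poly_ind: h => [|h c IHh]; first by rewrite rmorph0; apply: inalg0.
rewrite rmorphD rmorphM /= horner_algX horner_algC.
by apply: inalgD; [apply: inalgM | apply: inalgZ; apply: inalg1].
Qed.

Lemma inalg_gconj h a : h \in H -> inalg H a -> inalg H (gconj h a).
Proof. by move=> Hh Ha x Hx; rewrite ffunE Ha ?groupJr. Qed.

Lemma inalgE a : inalg H a -> a = \sum_(g in H) a g *: (gdelta F g : A).
Proof.
move=> Ha; rewrite {1}[a]galgE (bigID (mem H)) /= [X in _ + X]big1 ?addr0 // => g Hg.
by rewrite Ha ?scale0r.
Qed.

(** The coefficient of [a] at [x] is that of [a * x^-1] at 1: the bilinear form [lam (a * b)] is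
    nondegenerate. *)
Lemma inalg_eq0 a :
  inalg H a -> (forall h, h \in H -> (a * (gdelta F h : A)) 1%g = 0) -> a = 0.
Proof.
move=> Ha a0; apply/ffunP=> x; rewrite [RHS]ffunE.
have [Hx|/Ha//] := boolP (x \in H).
by have := a0 x^-1%g; rewrite gdelta_mulr mul1g invgK groupV; apply.
Qed.

Definition galg_central z := inalg H z /\ forall a, inalg H a -> a * z = z * a.

Lemma gconj_fixed_central z :
  inalg H z -> (forall h, h \in H -> gconj h z = z) -> galg_central z.
Proof.
move=> Hz fz; split=> // a Ha; rewrite (inalgE Ha) mulr_suml mulr_sumr.
apply: eq_bigr => h Hh; rewrite -scalerAl -scalerAr; congr (_ *: _).
by rewrite -{2}(fz h Hh) gconjE -[RHS]mulrA gdeltaM mulVg gdelta1 mulr1.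
Qed.

Lemma galg_centralM z w : galg_central z -> galg_central w -> galg_central (z * w).
Proof.
move=> [Hz cz] [Hw cw]; split=> [|a Ha]; first exact: inalgM.
by rewrite mulrA cz // -mulrA cw // mulrA.
Qed.

Lemma galg_centralB z w : galg_central z -> galg_central w -> galg_central (z - w).
Proof.
move=> [Hz cz] [Hw cw]; split=> [|a Ha]; first exact: inalgB.
by rewrite mulrBl mulrBr cz ?cw.
Qed.

Lemma galg_central1 : galg_central 1.
Proof. by split=> [|a Ha]; [apply: inalg1 | rewrite mulr1 mul1r]. Qed.

Lemma galg_centralX z n : galg_central z -> galg_central (z ^+ n).
Proof.
by move=> cz; elim: n => [|n IHn]; [apply: galg_central1 | rewrite exprS; apply: galg_centralM].
Qed.

Lemma galg_central_horner z (h : {poly F}) :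
  galg_central z -> galg_central (horner_alg z h).
Proof.
move=> [Hz cz]; split=> [|a Ha]; first exact: inalg_horner.
elim/poly_ind: h => [|h c IHh]; first by rewrite rmorph0 mulr0 mul0r.
rewrite rmorphD rmorphM /= horner_algX horner_algC mulrDl mulrDr mulr_algl mulr_algr.
by rewrite mulrA IHh -!mulrA cz.
Qed.

(** The relative trace from the trivial subgroup, written without coset representatives. *)
Definition trace1 a : A := \sum_(h in H) gconj h a.

Lemma rtrace1E a : rtrace 1%g H a = trace1 a.
Proof.
rewrite /rtrace (_ : lcosets 1%g H = [set [set h] | h in H]); last first.
  by apply: eq_imset => h; rewrite lcosetE mulg1.
rewrite big_imset /= => [|x y _ _]; last exact: set1_inj.
by apply: eq_bigr => h _; rewrite repr_set1.
Qed.

Lemma trace1_inalg a : inalg H a -> inalg H (trace1 a).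
Proof. by move=> Ha; apply: inalg_sum => h Hh; apply: inalg_gconj. Qed.

Lemma trace1_central a : inalg H a -> galg_central (trace1 a).
Proof.
move=> Ha; apply: gconj_fixed_central => [|h Hh]; first exact: trace1_inalg.
apply/ffunP=> z; rewrite ffunE !sum_ffunE [RHS](reindex_inj (mulgI h)) /=.
apply: eq_big => [x|x _]; first by rewrite groupMl.
by rewrite !ffunE conjgM.
Qed.

Fact trace1_is_linear : linear trace1.
Proof.
move=> c a b; rewrite /trace1 scaler_sumr -big_split; apply: eq_bigr => h _.
by apply/ffunP=> z; rewrite !ffunE.
Qed.

HB.instance Definition _ := GRing.isLinear.Build F A A _ trace1 trace1_is_linear.

Lemma trace1Mr a z : galg_central z -> trace1 (a * z) = trace1 a * z.
Proof.
move=> [_ cz]; rewrite mulr_suml; apply: eq_bigr => h Hh.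
by rewrite !gconjE -!mulrA cz //; apply: inalg_gdelta; rewrite groupV.
Qed.

Variable p : nat.

Lemma pplusE x : pplus F p H x = ((x \in H) && (p.-elt x)%g)%:R.
Proof.
rewrite /pplus sum_ffunE; case: andP => [Hx|nHx].
  rewrite (bigD1 x) /=; last exact/andP.
  rewrite big1 => [|y /andP[_ /negPf ny]]; first by rewrite ffunE eqxx addr0.
  by rewrite ffunE eq_sym ny.
rewrite big1 // => y /andP Hy; rewrite ffunE.
by case: eqP Hy => // <- /nHx.
Qed.

Lemma pplus_central : galg_central (pplus F p H).
Proof.
apply: gconj_fixed_central => [x Hx|h Hh]; first by rewrite pplusE (negPf Hx).
by apply/ffunP=> x; rewrite ffunE !pplusE groupJr // /p_elt orderJ.
Qed.

(** The set of p-elements is closed under inversion. *)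
Lemma coef1_pplus_mul a :
  ((pplus F p H : A) * a) 1%g = \sum_(g in H | (p.-elt g)%g) a g.
Proof.
rewrite galg_mulE ffunE [RHS]big_mkcond [RHS](reindex_inj invg_inj) /=.
apply: eq_bigr => x _; rewrite pplusE groupV /p_elt orderV mulg1.
by case: ifP; rewrite ?mul1r ?mul0r.
Qed.

(** Fact (1): as [p ^ k] is at least the p-part of the order of [H], the p-elements of [H] are the
    solutions in [H] of [g ^+ (p ^ k) = 1], and Frobenius moves the power inside the sum. *)
Lemma coef1_pplus_exp a k : p \in [pchar F] -> inalg H a ->
    (logn p #|H| <= k)%N ->
  ((pplus F p H : A) * a) 1%g ^+ (p ^ k) = (a ^+ (p ^ k)) 1%g.
Proof.
move=> pF Ha lek; have p_pr := pcharf_prime pF.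
have pq : p.-nat (p ^ k)%N by rewrite pnatX pnat_id.
have q_gt0 : (0 < p ^ k)%N by rewrite expn_gt0 prime_gt0.
rewrite coef1_pplus_mul coef1_exp_pchar // [RHS](bigID (mem H)) /=.
rewrite [X in _ = _ + X]big1 => [|g /andP[_ /Ha->]]; last first.
  by rewrite expr0n eqn0Ngt q_gt0.
rewrite addr0 (big_morph (fun c : F => c ^+ (p ^ k)) (id1 := 0) (op1 := +%R)).
- apply: eq_bigl => g; rewrite andbC; case Hg: (g \in H); rewrite ?andbF //.
  rewrite !andbT -order_dvdn /p_elt; apply/idP/idP=> [/p_natP[m gm]|/pnat_dvd]; last exact.
  rewrite gm dvdn_exp2l // (leq_trans _ lek) // -(pfactorK m p_pr) -gm.
  by rewrite dvdn_leq_log ?order_dvdG.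
- by move=> x y; apply: exprDn_pchar; rewrite (eq_pnat _ (pcharf_eq pF)).
- by rewrite expr0n eqn0Ngt q_gt0.
Qed.

End SubgroupAlgebra.

(** * The ideal T(FH) s and the blocks of defect zero *)

Section TraceIdeal.
Variables (F : closedFieldType) (gT : finGroupType) (H : {group gT}) (p : nat).
Local Notation A := (galg F gT).
Local Notation T := (@trace1 F gT H).
Local Notation s := (pplus F p H : A).
Local Notation central := (@galg_central F gT H).
Implicit Types a b y z : A.

(* The left-hand side is the trace of [x |-> a * x * y] on [F H]. *)
Lemma coef1_trace1_nilpotent a y n :
  inalg H a -> inalg H y -> y ^+ n = 0 -> (T a * y) 1%g = 0.
Proof.
move=> Ha Hy yn0.
(* Projection onto [FH]: it makes the map an endomorphism of the full function space, and basis
   elements outside [H] add nothing to its trace. *)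
pose P (x : A) : A := [ffun g => if g \in H then x g else 0].
have HP x : inalg H (P x) by move=> g /negPf ng; rewrite ffunE ng.
have P_id x : inalg H x -> P x = x.
  by move=> Hx; apply/ffunP=> g; rewrite ffunE; case: ifP => // /negbT/Hx.
pose f (x : A) : A := a * P x * y.
have lf : linear f.
  move=> c x z; rewrite /f scalerAl scalerAr -mulrDl -mulrDr; congr (_ * _ * _).
  by apply/ffunP=> g; rewrite !ffunE; case: ifP => _; rewrite ?scaler0 ?addr0.
have fX m x : iter m.+1 f x = a ^+ m.+1 * P x * y ^+ m.+1.
  elim: m => [|m IHm] //; rewrite iterS IHm /f P_id; last first.
    by apply: inalgM; [apply: inalgM => //|]; apply: inalgX.
  by rewrite [a ^+ m.+2]exprS [y ^+ m.+2]exprSr !mulrA.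
pose fL : {linear A -> A} := HB.pack f (GRing.isLinear.Build F A A _ f lf).
have := @nilpotent_linear_trace F gT fL n.+1.
have f0 x : iter n.+1 f x = 0 by rewrite fX [y ^+ _]exprS yn0 !mulr0.
move=> /(_ f0); rewrite (bigID (mem H)) /= [X in _ + X]big1 => [|g ng]; last first.
  rewrite /f (_ : P _ = 0) ?mulr0 ?mul0r ?ffunE //.
  by apply/ffunP=> x; rewrite !ffunE; case: ifP => // Hx; case: eqP Hx ng => // ->->.
(* After inverting [h], the summand is the coefficient of [h^-1 * a * h * y] at 1, which is the
   diagonal entry of the map at [h]. *)
rewrite addr0 => <-; rewrite mulr_suml sum_ffunE (reindex_inj invg_inj) /=.
apply: eq_big => [h|h]; rewrite groupV // => Hh.
rewrite gconjE invgK -!mulrA gdelta_mull invgK mulg1 /f -/(gdelta F h).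
by rewrite P_id ?mulrA //; apply: inalg_gdelta.
Qed.

Hypothesis pF : p \in [pchar F].

(** As [z] is central, its product with any [h] in [H] is again nilpotent, so fact (2) kills every
    coefficient. *)
Lemma trace1_mul_nilpotent a z n :
  inalg H a -> central z -> z ^+ n = 0 -> T a * z = 0.
Proof.
move=> Ha [Hz cz] zn0; apply: (@inalg_eq0 _ _ H) => [|h Hh].
  exact/inalgM/Hz/trace1_inalg.
have Hd := inalg_gdelta F Hh; rewrite -mulrA.
apply: (coef1_trace1_nilpotent (n := n)) => //; first exact: inalgM.
by rewrite exprMn_comm ?zn0 ?mul0r //; apply/esym/cz.
Qed.

Lemma pplus_mul_nilpotent z n : central z -> z ^+ n = 0 -> s * z = 0.
Proof.
move=> [Hz cz] zn0; have [Hs _] := pplus_central F H p.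
apply: (@inalg_eq0 _ _ H) => [|h Hh]; first exact: inalgM.
have Hd := inalg_gdelta F Hh; rewrite -mulrA.
(* This [k] is large enough both for fact (1) and for [p ^ k] to exceed the nilpotency exponent
   [n]. *)
have Hx := inalgM Hz Hd; pose k := (logn p #|H| + n)%N.
have := coef1_pplus_exp (k := k) pF Hx (leq_addr _ _).
rewrite exprMn_comm; last exact/esym/cz.
have -> : z ^+ (p ^ k) = 0.
  have lenk : (n <= p ^ k)%N.
    rewrite (leq_trans (leq_addl (logn p #|H|) n)) // ltnW // ltn_expl //.
    exact: prime_gt1 (pcharf_prime pF).
  by rewrite -(subnK lenk) exprD zn0 mulr0.
by rewrite mul0r [RHS]ffunE => /eqP; rewrite expf_eq0 => /andP[_ /eqP].
Qed.

Lemma trace_ideal_reduced a :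
  inalg H a -> (T a * s) * (T a * s) = 0 -> T a * s = 0.
Proof.
move=> Ha zz0; set t := T a in zz0 *.
have ct : central t by apply: trace1_central.
have cs : central s by apply: pplus_central.
have tts0 : t * t * s = 0.
  rewrite -mulrA; apply: (trace1_mul_nilpotent (n := 2)) => //.
  exact: galg_centralM.
have p_gt1 : (1 < p)%N by apply: prime_gt1 (pcharf_prime pF).
have [h h0 [N tN]] := exists_root_mod_nilpotent t (ltnW p_gt1).
(* Since [h] vanishes at 0, [h(t)] is a multiple of [t]; as [p] is at least 2, [h(t)^p] is then a
   multiple of [t * t], which [s] annihilates. *)
have [k hE] : exists k, h = k * ('X - 0%:P) by apply/factor_theorem/rootP.
have ck := galg_central_horner k ct.
have htE : horner_alg t h = horner_alg t k * t.
  by rewrite hE subr0 rmorphM /= horner_algX.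
rewrite htE in tN.
have cn : central (t - (horner_alg t k * t) ^+ p).
  by apply/galg_centralB/galg_centralX/galg_centralM.
have /eqP := pplus_mul_nilpotent cn tN.
rewrite mulrBr subr_eq0 (cs.2 t ct.1) => /eqP->.
rewrite -(cs.2 _ (inalgX _ (inalgM ck.1 ct.1))).
rewrite exprMn_comm; last exact: ct.2 ck.1.
rewrite -[in t ^+ p](subnK p_gt1) exprD expr2 -[_ * _ * s]mulrA -[_ * _ * s]mulrA.
by rewrite tts0 !mulr0.
Qed.

Lemma trace1_idempotent_pplus_eq0 a :
  inalg H a -> T a * T a = T a -> T a * s = 0 -> T a = 0.
Proof.
move=> Ha; set e := T a => ee es0.
have ce : central e by apply: trace1_central.
have cs : central s by apply: pplus_central.
apply: (@inalg_eq0 _ _ H) => [|h Hh]; first exact: ce.1.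
have Hb := inalg_gdelta F Hh; set b : A := gdelta F h in Hb *.
pose q := (p ^ logn p #|H|)%N.
have q_gt0 : (0 < q)%N by rewrite expn_gt0 prime_gt0 ?(pcharf_prime pF).
have [k _ [N bN]] := exists_root_mod_nilpotent b q_gt0.
have Hk := inalg_horner k Hb.
(* Fact (2) allows replacing [b] by the power [horner_alg b k ^+ q] under [lam (e * _)]; [e], a
   central idempotent, then moves inside the power. *)
have := coef1_trace1_nilpotent Ha (inalgB Hb (inalgX q Hk)) bN.
rewrite -/e mulrBr ffunE [X in _ + X]ffunE => /eqP; rewrite subr_eq0 => /eqP->.
have eX n : e ^+ n.+1 = e by elim: n => // n IHn; rewrite exprS IHn.
have -> : e * horner_alg b k ^+ q = (e * horner_alg b k) ^+ q.
  rewrite exprMn_comm; last exact/esym/ce.2.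
  by rewrite -[in e ^+ q](prednK q_gt0) eX.
have := coef1_pplus_exp pF (inalgM ce.1 Hk) (leqnn _).
rewrite -/q mulrA -(cs.2 _ ce.1) es0 mul0r => <-.
by rewrite ffunE expr0n eqn0Ngt q_gt0.
Qed.

(** As [s] is central, the generators are [T(g) * s], so their span is the image of the linear map
    [a |-> T(a) * s]. *)
Lemma mem_WQ1 z :
  z \in WQ F p H 1%g <-> exists2 a : A, inalg H a & z = T a * s.
Proof.
have cs : central s by apply: pplus_central.
pose X : seq A := [seq T (gdelta F g : A) * s | g <- enum H].
have WE : WQ F p H 1%g = <<X>>%VS.
  congr (<<_>>)%VS; apply: eq_map => g; rewrite -trace1Mr //.
  exact: rtrace1E.
rewrite WE; split=> [/(@coord_span _ _ _ (in_tuple X))->|[a Ha ->]].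
  elim/big_ind: _ => [|x y [a Ha ->] [b Hb ->]|i _].
  - by exists 0; [apply: inalg0 | rewrite linear0 mul0r].
  - by exists (a + b); [apply: inalgD | rewrite linearD mulrDl].
  have : X`_i \in X by rewrite mem_nth ?ltn_ord.
  case/mapP=> g; rewrite mem_enum => Hg ->.
  exists (coord (in_tuple X) i z *: (gdelta F g : A)).
    by apply/inalgZ/inalg_gdelta.
  by rewrite linearZ -scalerAl.
rewrite (inalgE Ha) linear_sum mulr_suml memv_suml // => g Hg.
rewrite linearZ -scalerAl memvZ // memv_span //.
by apply/mapP; exists g; rewrite ?mem_enum.
Qed.

Lemma WQ1_ideal z w : central z -> w \in WQ F p H 1%g -> (z * w : A) \in WQ F p H 1%g.
Proof.
move=> cz /mem_WQ1[a Ha ->]; apply/mem_WQ1; exists (a * z).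
  exact: inalgM cz.1.
by rewrite trace1Mr // mulrA -cz.2 //; apply: trace1_inalg.
Qed.

Lemma WQ1_central w : w \in WQ F p H 1%g -> central w.
Proof.
by case/mem_WQ1=> a Ha ->; apply/galg_centralM/pplus_central/trace1_central.
Qed.

Lemma central_idemP e : central_idem H e <-> central e /\ (e : A) * e = e.
Proof. by split=> [[He [ce ee]]|[[He ce] ee]]. Qed.

Lemma WQ1_basis_defect_zero_blocks :
  exists l : seq {ffun gT -> F^o},
    [/\ uniq l, forall e, e \in l <-> defect_zero_block p H e
      & size l = \dim (WQ F p H 1%g)].
Proof.
pose U : {vspace A} := WQ F p H 1%g.
have cU w : w \in U -> central w by apply: WQ1_central.
have [||| l [bl idl orthl]] := @reduced_idempotent_basis F A U.
- by move=> z w Uz Uw; apply: WQ1_ideal (cU _ Uz) Uw.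
- by move=> z w /cU cz /cU cw; apply: cw.2 cz.1.
- by move=> z /mem_WQ1[a Ha ->]; apply: trace_ideal_reduced.
have freel := basis_free bl; have lU e : e \in l -> e \in U by apply: basis_mem.
(* By orthogonality, multiplying an element of [U] by [e] leaves only its [e]-component. *)
have mulUl e z : e \in l -> z \in U -> exists c, z * e = c *: e.
  move=> le; rewrite -(span_basis bl) => /(@coord_span _ _ _ (in_tuple l))->; rewrite mulr_suml.
  elim/big_ind: _ => [|x y [c ->] [d ->]|i _].
  - by exists 0; rewrite scale0r.
  - by exists (c + d); rewrite scalerDl.
  have li : l`_i \in l by rewrite mem_nth ?ltn_ord.
  rewrite /= -scalerAl; have [->|nei] := eqVneq l`_i e.
    by rewrite idl //; eexists.
  by rewrite orthl //; exists 0; rewrite scaler0 scale0r.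
have nzl e : e \in l -> e != 0.
  by move=> le; apply: contraTneq le => ->; apply/negP=> /(free_not0 freel); rewrite eqxx.
exists l; split; [exact: free_uniq freel | | by rewrite -(eqP freel) (span_basis bl)].
suff lP (e : A) : e \in l <-> defect_zero_block p H e by exact: lP.
split=> [le|[[ /central_idemP[ce ee] [nze prime_e]] [_ _ [a [Ha _] eT] _]]].
  have Ue := lU _ le; split; last first.
    split; [exact: sub1G | exact: pgroup1 | | by move=> E; rewrite properE sub1G andbF].
    have /mem_WQ1[a Ha eE] := Ue.
    have [Hs cs] := pplus_central F H p.
    (* Centrality of [s] turns [T(a) * s] into the trace of [a * s]. *)
    exists (a * s); last by rewrite rtrace1E trace1Mr //; apply: pplus_central.
    split=> [|x]; first exact: inalgM.
    by move/set1P->; apply/ffunP=> z; rewrite ffunE conjg1.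
  split; first by apply/central_idemP; split; [apply: cU | apply: idl].
  split=> [|[e1 [e2 [/central_idemP[c1 ee1] [/central_idemP[c2 ee2] [nz1 [nz2 [e12 eE]]]]]]]]; first exact: nzl.
  have {}e12 : (e1 : A) * e2 = 0 by [].
  have {}eE : e = (e1 : A) + e2 by [].
  have e21 : (e2 : A) * e1 = 0 by rewrite (c1.2 _ c2.1).
  have E1 : (e1 : A) * e = e1 by rewrite eE mulrDr ee1 e12 addr0.
  have E2 : (e2 : A) * e = e2 by rewrite eE mulrDr ee2 e21 add0r.
  (* Both summands become multiples of [e], so their orthogonality forces one of them to vanish. *)
  have [c E1c] := mulUl e _ le (WQ1_ideal c1 Ue).
  have [d E2d] := mulUl e _ le (WQ1_ideal c2 Ue).
  rewrite E1 E1 in E1c; rewrite E2 E2 in E2d.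
  move/eqP: e12; rewrite E2d -scalerAr E1 scaler_eq0 (negPf nz1) orbF => /eqP d0.
  by move: nz2; rewrite E2d d0 scale0r eqxx.
have eTa : e = T a by rewrite eT rtrace1E.
have Us : e * s \in U by apply/mem_WQ1; exists a; rewrite ?eTa.
have nzes : e * s != 0.
  apply: contraNneq nze => es0; rewrite eTa.
  by apply/eqP/trace1_idempotent_pplus_eq0; rewrite -?eTa.
(* Otherwise [e] would annihilate all of [U], in particular [e * s], although [e * (e * s) = e * s]
   is nonzero. *)
have /hasP[f lf nzef] : has (fun f => (e : A) * f != 0) l.
  apply: contraT; rewrite -all_predC => /allP el0.
  case/eqP: nzes; rewrite -{1}ee -mulrA.
  move: Us; rewrite -(span_basis bl) => /(@coord_span _ _ _ (in_tuple l))->.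
  rewrite mulr_sumr big1 // => i _; rewrite -scalerAr.
  have /el0 : l`_i \in l by rewrite mem_nth ?ltn_ord.
  by rewrite /= negbK => /eqP->; rewrite scaler0.
have cf := cU f (lU f lf).
have [c efc] := mulUl f _ lf (WQ1_ideal ce (lU f lf)).
rewrite -mulrA idl // in efc.
have nzc : c != 0 by apply: contraNneq nzef => c0; rewrite efc c0 scale0r.
have eff : e * f = f.
  have : e * (e * f) = e * f by rewrite mulrA ee.
  rewrite efc -scalerAr efc => cff.
  by apply: (scalerI nzc).
have fe : f * e = f by rewrite (ce.2 _ cf.1).
have ff : f * f = f by apply: idl.
have [->//|nef] := eqVneq e f.
(* If [e] differed from [f], then [f] and [e - f] would decompose it. *)
case: prime_e; exists f, (e - f); split; first exact/central_idemP.
split; first apply/central_idemP.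
  split; first exact: galg_centralB.
  by rewrite mulrBl !mulrBr ee eff fe ff subrr subr0.
split; first exact: nzl.
split; first by rewrite subr_eq0.
split; last by rewrite addrC subrK.
by rewrite -galg_mulE mulrBr fe ff subrr.
Qed.

End TraceIdeal.

(** * Passage to the quotient *)

Section Inflation.
Variables (F : closedFieldType) (gT : finGroupType) (G Q : {group gT}) (p : nat).
Hypotheses (nQG : (Q <| G)%g) (pQ : (p.-group Q)%g).

(* The test is needed: [coset Q g] is the trivial coset when [g] is outside the
   normaliser of [Q]. *)
Definition coset_sum (b : galg F (coset_of Q)) : galg F gT :=
  [ffun g => if g \in G then b (coset Q g) else 0].

Fact coset_sum_is_linear : linear coset_sum.
Proof.
move=> c a b; apply/ffunP=> g; rewrite !ffunE.
by case: ifP => _; rewrite ?scaler0 ?addr0.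
Qed.

HB.instance Definition _ :=
  GRing.isLinear.Build F (galg F (coset_of Q)) (galg F gT) _ coset_sum
    coset_sum_is_linear.

(** As [Q] is a p-group, the image of the cyclic group of [x] is a p-group exactly when that group
    is one. *)
Lemma pplus_quotient x :
  x \in G -> pplus F p (G / Q)%g (coset Q x) = pplus F p G x.
Proof.
move=> Gx; have Nx := subsetP (normal_norm nQG) x Gx.
rewrite !pplusE Gx mem_quotient //; congr (nat_of_bool _)%:R.
have sxN : <[x]>%g \subset 'N(Q)%g by rewrite cycle_subG.
by rewrite /p_elt !orderE -quotient_cycle // [LHS](pquotient_pgroup pQ sxN).
Qed.

Lemma repr_lcosets C :
  C \in lcosets Q G -> repr C \in G /\ C = (repr C *: Q)%g.
Proof.
case/lcosetsP=> x Gx ->; have xr := mem_repr x (lcoset_refl Q x).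
split; last by apply/esym/lcoset_eqP.
case/lcosetP: xr => u Qu ->; rewrite groupM //.
exact: subsetP (normal_sub nQG) u Qu.
Qed.

(** Left and right cosets of the normal subgroup [Q] coincide, so the representatives map
    bijectively onto [G / Q]. *)
Lemma big_lcosets_quotient (f : coset_of Q -> F) :
  \sum_(C in lcosets Q G) f (coset Q (repr C)) = \sum_(h in (G / Q)%g) f h.
Proof.
have sGN := subsetP (normal_norm nQG).
have -> : (G / Q)%g = [set coset Q (repr C) | C in lcosets Q G].
  apply/setP=> h; apply/idP/imsetP=> [/morphimP[x Nx Gx ->]|[C /repr_lcosets[Gr _] ->]].
    have lx : (x *: Q)%g \in lcosets Q G by apply/lcosetsP; exists x.
    exists (x *: Q)%g => //; have [Gr /lcoset_eqP xr] := repr_lcosets lx.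
    apply/rcoset_kercosetP; rewrite ?sGN //.
    by rewrite norm_rlcoset ?sGN.
  exact: mem_quotient.
rewrite [RHS]big_imset //= => C D /repr_lcosets[GC CE] /repr_lcosets[GD DE].
move/rcoset_kercosetP; rewrite !sGN // norm_rlcoset ?sGN // => /(_ isT isT) CD.
by rewrite CE DE; apply/lcoset_eqP.
Qed.

(** At [z] in [G] both sides count, over the same cosets, when a translate of a conjugate of [z] is
    a p-element, which can be tested modulo [Q]. *)
Lemma coset_sum_rtrace g : g \in G ->
  coset_sum (rtrace 1%g (G / Q)%g (gmul (gdelta F (coset Q g)) (pplus F p (G / Q)%g)))
  = rtrace Q G (gmul (gdelta F g) (pplus F p G)).
Proof.
move=> Gg; have sGN := subsetP (normal_norm nQG).
apply/ffunP=> z; rewrite ffunE rtrace1E sum_ffunE [RHS]sum_ffunE.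
have reprG C : C \in lcosets Q G -> repr C \in G by case/repr_lcosets.
case: ifP => Gz; last first.
  rewrite big1 // => C /reprG Gr; rewrite ffunE gdelta_mull pplusE.
  by rewrite groupMl ?groupV // groupJr // Gz.
rewrite -big_lcosets_quotient; apply: eq_bigr => C /reprG Gr.
rewrite [LHS]ffunE [RHS]ffunE !gdelta_mull -pplus_quotient ?groupM ?groupV ?groupJ //.
by rewrite morphM ?morphV ?morphJ ?sGN ?groupV ?groupJ ?sGN.
Qed.

Lemma dim_WQ_quotient : \dim (WQ F p G Q) = \dim (WQ F p (G / Q)%g 1%g).
Proof.
rewrite -(limg_dim_eq (f := linfun coset_sum)); last first.
  (* [coset_sum] forgets values outside [G / Q]; it is injective here because elements of the ideal
     are supported on [G / Q]. *)
  apply/eqP; rewrite -subv0; apply/subvP=> b; rewrite memv_cap memv_ker memv0.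
  case/andP=> /(WQ1_central (H := (G / Q)%G))[Hb _].
  rewrite lfunE /= => /eqP/ffunP b0; apply/eqP/ffunP=> h; rewrite [RHS]ffunE.
  have [/morphimP[x _ Gx ->]|/Hb//] := boolP (h \in (G / Q)%g).
  by have := b0 x; rewrite !ffunE Gx.
rewrite limg_span; congr (\dim _); apply: eq_span => a.
apply/mapP/mapP=> [[g]|[b /mapP[h]]]; rewrite mem_enum.
  move=> Gg ->; eexists; first by apply/mapP; exists (coset Q g); rewrite // mem_enum mem_quotient.
  by rewrite lfunE /= coset_sum_rtrace.
case/morphimP=> g _ Gg -> -> ->; exists g; rewrite ?mem_enum //.
by rewrite lfunE /= coset_sum_rtrace.
Qed.

End Inflation.

Theorem theorem1 (F : closedFieldType) (p : nat) (gT : finGroupType)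
    (G Q : {group gT}) :
  p \in [pchar F] -> (Q <| G)%g -> (p.-group Q)%g ->
  exists s : seq {ffun coset_of Q -> F^o},
    [/\ uniq s,
        (forall e, e \in s <-> defect_zero_block p (G / Q)%g e)
      & size s = \dim (WQ F p G Q)].
Proof.
move=> pF nQG pQ; rewrite dim_WQ_quotient //.
exact: (@WQ1_basis_defect_zero_blocks F (coset_of Q) (G / Q)%G p pF).
Qed.
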